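(* Let $L\ge 2$, $k\ge 2$ and $d\ge 2$ be integers, let $P=p_1\cdots p_d$ be a pattern of length $d$ over $\{0,1,\dots,k-1\}$, let $\mu_P:\mathbb{N}\to\{0,1,\dots,L-1\}$ be a map, and let $(a(n))_{n\ge 0}$ be the $(L,k,P,\mu_P)$-RS sequence. The sequence $(a(n))_{n\ge0}$ is ultimately periodic if and only if there exists an integer $A$ such that $\mu_P(y)=0$ for every non-negative integer $y$ with $y\ge A$. Moreover, if $(a(n))_{n\ge0}$ is not ultimately periodic, then no arithmetical subsequence of it is ultimately periodic.
   Context: $\mathbb{N}$ denotes the set of non-negative integers. For an integer $k\ge2$, the base $k$-representation of a non-negative integer $n$ is $n=\sum_{q\ge 0}s_{n,q}k^q$ with $0\le s_{n,q}\le k-1$ (so $s_{n,q}=0$ for all large $q$). A pattern of length $d$ is a word $P=p_1\cdots p_d$ with $p_i\in\{0,1,\dots,k-1\}$ not all equal to $0$. Given $P$ and a map $\mu_P:\mathbb{N}\to\{0,1,\dots,L-1\}$, for $n,y\in\mathbb{N}$ put $d_1(n;p_dk^y+\cdots+p_1k^{y+d-1})=\mu_P(y)$ if $p_dk^y+\cdots+p_1k^{y+d-1}$ appears in the base $k$-representation of $n$, i.e. if $s_{n,y+d-i}=p_i$ for all $1\le i\le d$ (leading zeros of $n$ being allowed), and $d_1(n;p_dk^y+\cdots+p_1k^{y+d-1})=0$ otherwise. The $(L,k,P,\mu_P)$-RS sequence is the sequence $(a(n))_{n\ge0}$ with $0\le a(n)\le L-1$ and $$a(n)\equiv\sum_{y=0}^\infty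 d_1(n;p_dk^y+\cdots+p_1k^{y+d-1})\pmod L$$ (the sum has finitely many non-zero terms, and $a(0)=0$). A sequence $(c(n))_{n\ge0}$ is ultimately periodic if there exist integers $N\ge0$ and $l>0$ such that $c(n)=c(n+l)$ for all $n\ge N$. An arithmetical subsequence of $(c(n))_{n\ge0}$ is a sequence $(c(N+tl))_{t\ge0}$ with integers $N\ge0$ and $l>0$. *)

(* Defs.v *)
From mathcomp Require Import all_boot all_order all_algebra.

Set Implicit Arguments.
Unset Strict Implicit.
Unset Printing Implicit Defensive.

Definition digit (k n q : nat) : nat := n %/ k ^ q %% k.

Lemma digit_expansion (k n M : nat) :
  n < k ^ M -> n = \sum_(q < M) digit k n q * k ^ q.
Proof.
have expand m : n = n %/ k ^ m * k ^ m + \sum_(q < m) digit k n q * k ^ q.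
  elim: m => [|m IHm]; first by rewrite big_ord0 expn0 divn1 muln1 addn0.
  rewrite big_ord_recr /= [_ + digit k n m * _]addnC addnA [LHS]IHm.
  congr (_ + _); rewrite /digit expnSr divnMA [k ^ m * k]mulnC mulnA -mulnDl.
  by rewrite -divn_eq.
by move=> ltn; rewrite [LHS](expand M) divn_small.
Qed.

(* [tnth P i] is the letter p_(i+1) of the pattern; the leftmost letter
   sits at the highest position y + d - 1. *)
Definition appears (k d : nat) (P : d.-tuple 'I_k) (n y : nat) : bool :=
  [forall i : 'I_d, digit k n (y + d - i.+1) == tnth P i].

Definition d1 (L k d : nat) (P : d.-tuple 'I_k) (mu : nat -> 'I_L)
    (n y : nat) : nat :=
  if appears P n y then nat_of_ord (mu y) else 0.

(* The sum over all y >= 0 is cut at y = n: for a nonzero pattern all later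
   terms vanish, see [d1_eq0] and [RS_seqE]. *)
Definition RS_seq (L k d : nat) (P : d.-tuple 'I_k) (mu : nat -> 'I_L)
    (n : nat) : nat :=
  (\sum_(y < n.+1) d1 P mu n y) %% L.

Definition nonzero_pattern (k d : nat) (P : d.-tuple 'I_k) : Prop :=
  exists i : 'I_d, tnth P i <> 0 :> nat.

Lemma d1_eq0 (L k d : nat) (P : d.-tuple 'I_k) (mu : nat -> 'I_L) (n y : nat) :
  1 < k -> nonzero_pattern P -> n < y -> d1 P mu n y = 0.
Proof.
move=> k_gt1 [i Pi_neq0] lt_ny; rewrite /d1; case: ifP => // /forallP /(_ i).
rewrite /digit divn_small ?mod0n; first by move/eqP/esym/Pi_neq0.
apply: leq_trans (ltn_expl _ k_gt1) _; rewrite leq_exp2l //.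
by rewrite -addnBA ?ltn_ord // (leq_trans (ltnW lt_ny)) // leq_addr.
Qed.

Lemma RS_seqE (L k d : nat) (P : d.-tuple 'I_k) (mu : nat -> 'I_L)
    (n M : nat) :
  1 < k -> nonzero_pattern P -> n < M ->
  RS_seq P mu n = (\sum_(y < M) d1 P mu n y) %% L.
Proof.
move=> k_gt1 P_neq0 lt_nM; rewrite /RS_seq -!(big_mkord xpredT (d1 P mu n)).
rewrite (big_cat_nat (leq0n n.+1) lt_nM) /=.
suff -> : \sum_(n.+1 <= y < M) d1 P mu n y = 0 by rewrite addn0.
rewrite big_nat_cond big1 // => y /andP[/andP[lt_ny _] _].
exact: d1_eq0.
Qed.

Definition ultimately_periodic (T : Type) (c : nat -> T) : Prop :=
  exists N l : nat, 0 < l /\ forall n, N <= n -> c n = c (n + l).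

Definition arith_subseq (T : Type) (c : nat -> T) (N l : nat) : nat -> T :=
  fun t => c (N + t * l).

(* Main.v *)
Require Import Defs.
From mathcomp Require Import all_boot all_order all_algebra.
From mathcomp Require Import zify.

(** The theorem reduces to one claim: if some arithmetical subsequence of the
    RS sequence [a] is ultimately periodic, then [mu] vanishes from some point
    on.  The converse implication is easy: when [mu y = 0] for [y >= A], the
    value [a n] is read off the lowest [A + d] digits of [n], so that
    [k ^ (A + d)] is a period.

    For the claim, a periodic arithmetical subsequence contains a constant one,
    so let [a] be constant on the numbers [N + t * l].  Occurrences of a nonzero
    pattern in two blocks of digits separated by [d] zeros do not interact, so
    [a] is additive on such pairs of blocks.  Every multiple [x] of a large
    power of [k] enters the progression after a low-order correction that
    depends only on [x %% l]; by additivity, [a x] depends only on [x %% l] for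
    these [x] ([RS_seq_eq_mod]).  Powers of [k] are eventually periodic modulo
    [l], so a summand [k ^ u] can be replaced by a power [k ^ v] lying far above
    the digits of [x] without changing any residue; hence
    [a (x + k ^ u) = a x + a (k ^ u)] modulo [L] even when the digits of the two
    summands touch or a carry occurs ([RS_seq_addX]).

    It remains to find one large power [k ^ u] with [a (k ^ u) = 0]: then [a]
    vanishes on all multiples of [k ^ u], in particular on the number whose only
    nonzero digits are those of the pattern placed at [y >= u], where [a] takes
    the value [mu y] ([RS_seq_word]).  If the pattern does not occur in
    [k ^ u], this is immediate.  Otherwise its only nonzero letter is a 1, and it
    has a 0 next to it because [d >= 2]; runs of two or three consecutive digits
    1 then show that inserting one more 1 need not change the occurrences
    ([RS_seq_power_eq0]). *)

Set Implicit Arguments.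
Unset Strict Implicit.
Unset Printing Implicit Defensive.

(** * Digits *)

Lemma digit_small (k n m q : nat) :
  1 < k -> n < k ^ m -> m <= q -> digit k n q = 0.
Proof.
move=> k_gt1 lt_n le_mq; rewrite /digit divn_small ?mod0n //.
by apply: leq_trans lt_n _; rewrite leq_exp2l.
Qed.

Lemma digit_mulX (k m z q : nat) :
  1 < k -> digit k (k ^ m * z) q = if q < m then 0 else digit k z (q - m).
Proof.
move=> k_gt1; have X_gt0 j : 0 < k ^ j by rewrite expn_gt0 ltnW.
rewrite /digit; case: ltnP => [lt_qm | le_mq].
  have -> : k ^ m * z = k ^ q * (k ^ (m - q.+1) * z * k).
    by rewrite -{1}(subnKC lt_qm) addSnnS expnD expnS -!mulnA [k * _]mulnC -mulnA.
  by rewrite mulKn // modnMl.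
by rewrite -{1}(subnKC le_mq) expnD divnMl.
Qed.

Lemma digit_dvd (k n m q : nat) :
  1 < k -> k ^ m %| n -> q < m -> digit k n q = 0.
Proof.
by move=> k_gt1 /dvdnP[z ->] lt_qm; rewrite mulnC digit_mulX ?lt_qm.
Qed.

Lemma digitDr (k x z m q : nat) :
  1 < k -> k ^ m %| z -> q < m -> digit k (x + z) q = digit k x q.
Proof.
move=> k_gt1 dvd_z lt_qm; rewrite /digit.
have X_gt0 j : 0 < k ^ j by rewrite expn_gt0 ltnW.
case/dvdnP: dvd_z => c ->.
rewrite -(subnKC lt_qm) addSnnS expnD mulnCA [k ^ q * _]mulnC addnC divnMDl //.
by rewrite expnS mulnCA [k * _]mulnC modnMDl.
Qed.

Lemma digitD (k x z m q : nat) :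
  1 < k -> x < k ^ m -> k ^ m %| z ->
  digit k (x + z) q = digit k x q + digit k z q.
Proof.
move=> k_gt1 lt_x dvd_z; have [lt_qm | le_mq] := ltnP q m.
  by rewrite (digitDr _ k_gt1 dvd_z lt_qm) (digit_dvd k_gt1 dvd_z lt_qm) addn0.
rewrite (digit_small k_gt1 lt_x le_mq) add0n /digit.
case/dvdnP: dvd_z => c ->; have X_gt0 j : 0 < k ^ j by rewrite expn_gt0 ltnW.
rewrite -(subnKC le_mq) expnD !divnMA [_ + c * _]addnC divnMDl // mulnK //.
by rewrite (divn_small lt_x) addn0.
Qed.

Lemma digit_lt_base (k c q : nat) :
  1 < k -> c < k -> digit k c q = if q == 0 then c else 0.
Proof.
move=> k_gt1 lt_ck; case: q => [|q] /=; first by rewrite /digit divn1 modn_small.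
by apply: (@digit_small k c 1).
Qed.

Lemma digitX (k u q : nat) : 1 < k -> digit k (k ^ u) q = (q == u).
Proof.
move=> k_gt1; rewrite -[k ^ u]muln1 digit_mulX // digit_lt_base //.
by case: ltngtP => [||->]; rewrite ?subnn //; case: (q - u) (subn_gt0 u q) => // <-.
Qed.

Lemma ltn_digit_sum (k m : nat) (f : nat -> nat) :
  1 < k -> (forall t, f t < k) -> \sum_(t < m) f t * k ^ t < k ^ m.
Proof.
move=> k_gt1 lt_f; elim: m => [|m IHm]; first by rewrite big_ord0.
rewrite big_ord_recr /= expnS.
apply: (@leq_trans ((f m).+1 * k ^ m)); last by rewrite leq_mul2r lt_f orbT.
by rewrite mulSn ltn_add2r.
Qed.

Lemma digit_sum (k m q : nat) (f : nat -> nat) :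
  1 < k -> (forall t, f t < k) ->
  digit k (\sum_(t < m) f t * k ^ t) q = if q < m then f q else 0.
Proof.
move=> k_gt1 lt_f; elim: m => [|m IHm].
  by rewrite big_ord0 /digit div0n mod0n.
rewrite big_ord_recr /= (@digitD _ _ _ m) ?ltn_digit_sum ?dvdn_mull //.
rewrite IHm mulnC digit_mulX // digit_lt_base // ltnS subn_eq0.
by case: ltngtP => [_|_|->]; rewrite ?addn0.
Qed.

(** Powers of [k] modulo [l] take finitely many values and each determines the
    next one, so they are eventually periodic even when [k] and [l] share a
    factor. *)
Lemma expn_mod_periodic (k l : nat) :
  0 < l -> exists B s, 0 < s /\
    forall u t, B <= u -> k ^ (u + t * s) = k ^ u %[mod l].
Proof.
move=> l_gt0.
have [f fE] : exists f : 'I_l.+1 -> 'I_l, forall i, f i = k ^ i %% l :> nat.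
  by exists (fun i => Ordinal (ltn_pmod (k ^ i) l_gt0)).
have /injectivePn[i [j neq_ij eq_f]] : ~~ injectiveb f.
  by apply/injectiveP => /leq_card; rewrite !card_ord ltnn.
have {f fE eq_f} eq_ij : k ^ i = k ^ j %[mod l] by rewrite -!fE eq_f.
wlog lt_ij : i j neq_ij eq_ij / i < j.
  move=> IH; case: (ltngtP i j) => [lt_ij | lt_ji | /val_inj eq].
  - exact: (IH i j).
  - by apply: (IH j i); rewrite // eq_sym.
  - by rewrite eq eqxx in neq_ij.
exists (nat_of_ord i), (j - i); split=> [|u t le_iu]; first by rewrite subn_gt0.
elim: t => [|t IHt]; first by rewrite mul0n addn0.
move: (t * (j - i)) IHt (mulSn t (j - i)) => m IHt ->.
have -> : u + (j - i + m) = u + m - i + j by lia.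
have umE : u + m = u + m - i + i by lia.
by rewrite expnD -modnMmr -eq_ij modnMmr -expnD -umE.
Qed.

(** * Occurrences of the pattern *)

(** Reversed, so that an occurrence at [y] compares [letter P t] with the digit
    at [y + t]; the default value makes the word a finitely supported function
    of [t]. *)
Definition letter (k d : nat) (P : d.-tuple 'I_k) (t : nat) : nat :=
  nth 0 (rev (map (@nat_of_ord k) P)) t.

Lemma letter_default (k d : nat) (P : d.-tuple 'I_k) (t : nat) :
  d <= t -> letter P t = 0.
Proof. by move=> le_dt; rewrite /letter nth_default // size_rev size_map size_tuple. Qed.

Lemma letterE (k d : nat) (P : d.-tuple 'I_k) (i : 'I_d) :
  letter P (d - i.+1) = tnth P i.
Proof.
have lt_id := ltn_ord i.
rewrite /letter nth_rev size_map size_tuple; last by lia.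
have -> : d - (d - i.+1).+1 = i by lia.
by rewrite (nth_map (tnth P i)) ?size_tuple // -tnth_nth.
Qed.

Lemma letter_lt (k d : nat) (P : d.-tuple 'I_k) (t : nat) :
  0 < k -> letter P t < k.
Proof.
move=> k_gt0; have [le_dt | lt_td] := leqP d t; first by rewrite letter_default.
have lt_j : d - t.+1 < d by lia.
have -> : t = d - (Ordinal lt_j).+1 by rewrite /=; lia.
by rewrite letterE.
Qed.

Lemma letter_neq0 (k d : nat) (P : d.-tuple 'I_k) :
  nonzero_pattern P -> exists2 t, t < d & letter P t != 0.
Proof.
move=> [i Pi]; exists (d - i.+1); first by have := ltn_ord i; lia.
by rewrite letterE; apply/eqP.
Qed.

Lemma appearsP (k d : nat) (P : d.-tuple 'I_k) (n y : nat) :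
  reflect (forall t, t < d -> digit k n (y + t) = letter P t) (appears P n y).
Proof.
apply: (iffP forallP) => [app t lt_td | app i].
  have lt_j : d - t.+1 < d by lia.
  have -> : t = d - (Ordinal lt_j).+1 by rewrite /=; lia.
  by rewrite letterE -(eqP (app _)) addnBA.
have lt_id := ltn_ord i.
by rewrite -letterE -app ?addnBA //; lia.
Qed.

Lemma eq_appears (k d : nat) (P : d.-tuple 'I_k) (n n' y : nat) :
  (forall t, t < d -> digit k n (y + t) = digit k n' (y + t)) ->
  appears P n y = appears P n' y.
Proof.
by move=> eq_nn'; apply/appearsP/appearsP => app t lt_td;
  rewrite -app // eq_nn'.
Qed.

Lemma appears_zeros (k d : nat) (P : d.-tuple 'I_k) (n y : nat) :
  nonzero_pattern P -> (forall t, t < d -> digit k n (y + t) = 0) ->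
  appears P n y = false.
Proof.
move=> /letter_neq0[t lt_td Pt] dig0; apply/appearsP => app.
by rewrite -app // dig0 in Pt.
Qed.

Definition word_at (k d : nat) (P : d.-tuple 'I_k) (y : nat) : nat :=
  k ^ y * \sum_(t < d) letter P t * k ^ t.

Lemma digit_word_at (k d : nat) (P : d.-tuple 'I_k) (y q : nat) :
  1 < k -> digit k (word_at P y) q = if q < y then 0 else letter P (q - y).
Proof.
move=> k_gt1; rewrite digit_mulX // digit_sum // => [|t]; last exact/letter_lt/ltnW.
by case: (ltnP (q - y)) => // /letter_default ->.
Qed.

(** A shifted occurrence would make the finitely supported word invariant under
    a nonzero shift, hence zero. *)
Lemma appears_word_at (k d : nat) (P : d.-tuple 'I_k) (y y' : nat) :
  1 < k -> nonzero_pattern P -> appears P (word_at P y) y' = (y' == y).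
Proof.
move=> k_gt1 P_neq0; case: ltngtP => [lt_y'y | lt_yy' | ->].
- apply/appearsP => app; case: (letter_neq0 P_neq0) => t lt_td /negP[].
  elim/ltn_ind: t lt_td => t IHt lt_td; rewrite -app // digit_word_at //.
  by case: ltnP => // le; apply: IHt; lia.
- apply/appearsP => app; case: (letter_neq0 P_neq0) => t _ /negP[].
  have shift t' : letter P t' = letter P (t' + (y' - y)).
    have [le_dt | lt_td] := leqP d t'; first by rewrite !letter_default //; lia.
    rewrite -app // digit_word_at // ltnNge (leq_trans (ltnW lt_yy')) ?leq_addr //=.
    by congr letter; lia.
  have shifts j : letter P t = letter P (t + j * (y' - y)).
    elim: j => [|j ->]; first by rewrite mul0n addn0.
    by rewrite [LHS]shift mulSn; congr letter; lia.
  rewrite (shifts d) letter_default // -[d in d <= _]muln1.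
  by apply: leq_trans (leq_addl _ _); rewrite leq_mul2l subn_gt0 lt_yy' orbT.
- by apply/appearsP => t _; rewrite digit_word_at // ltnNge leq_addr addKn.
Qed.

(** Each window of length [d] meets the digits of at most one of the two
    summands. *)
Lemma d1D (L k d : nat) (P : d.-tuple 'I_k) (mu : nat -> 'I_L) (x z m y : nat) :
  1 < k -> nonzero_pattern P -> x < k ^ m -> k ^ (m + d) %| z ->
  d1 P mu (x + z) y = d1 P mu x y + d1 P mu z y.
Proof.
move=> k_gt1 P_neq0 lt_x dvd_z.
have dig q : digit k (x + z) q = digit k x q + digit k z q.
  by apply: (digitD _ k_gt1 lt_x); apply: dvdn_trans dvd_z; rewrite dvdn_exp2l ?leq_addr.
rewrite /d1; have [le_my | lt_ym] := leqP m y.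
  have x0 t : digit k x (y + t) = 0 by apply: (digit_small k_gt1 lt_x); lia.
  rewrite (@appears_zeros _ _ _ x) // (@eq_appears _ _ _ _ z) // => t _.
  by rewrite dig x0.
have z0 t : t < d -> digit k z (y + t) = 0.
  by move=> lt_td; apply: (digit_dvd k_gt1 dvd_z); lia.
rewrite (@appears_zeros _ _ _ z) // addn0 (@eq_appears _ _ _ _ x) // => t lt_td.
by rewrite dig z0 // addn0.
Qed.

(** * Values of the RS sequence *)

Lemma RS_seq0 (L k d : nat) (P : d.-tuple 'I_k) (mu : nat -> 'I_L) :
  nonzero_pattern P -> RS_seq P mu 0 = 0.
Proof.
move=> P_neq0; rewrite /RS_seq big1 ?mod0n // => y _.
by rewrite /d1 appears_zeros // => t _; rewrite /digit div0n mod0n.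
Qed.

Lemma RS_seqD (L k d : nat) (P : d.-tuple 'I_k) (mu : nat -> 'I_L)
    (x z : nat) :
  1 < k -> nonzero_pattern P ->
  (forall y, d1 P mu (x + z) y = d1 P mu x y + d1 P mu z y) ->
  RS_seq P mu (x + z) = RS_seq P mu x + RS_seq P mu z %[mod L].
Proof.
move=> k_gt1 P_neq0 d1E.
rewrite !(@RS_seqE _ _ _ _ _ _ (x + z).+1) // ?ltnS ?leq_addr ?leq_addl //.
by rewrite modn_mod modnDm -big_split /=; congr (_ %% _); apply: eq_bigr.
Qed.

Lemma eq_RS_seq (L k d : nat) (P : d.-tuple 'I_k) (mu : nat -> 'I_L)
    (x z : nat) :
  1 < k -> nonzero_pattern P -> (forall y, appears P x y = appears P z y) ->
  RS_seq P mu x = RS_seq P mu z.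
Proof.
move=> k_gt1 P_neq0 eq_app.
rewrite !(@RS_seqE _ _ _ _ _ _ (x + z).+1) // ?ltnS ?leq_addr ?leq_addl //.
by congr (_ %% _); apply: eq_bigr => y _; rewrite /d1 eq_app.
Qed.

Lemma RS_seq_word (L k d : nat) (P : d.-tuple 'I_k) (mu : nat -> 'I_L)
    (y : nat) :
  1 < k -> nonzero_pattern P -> RS_seq P mu (word_at P y) = mu y.
Proof.
move=> k_gt1 P_neq0.
rewrite (@RS_seqE _ _ _ _ _ _ (word_at P y + y).+1) ?ltnS ?leq_addr //.
have lt_y : y < (word_at P y + y).+1 by rewrite ltnS leq_addl.
rewrite (bigD1 (Ordinal lt_y)) //= big1 ?addn0 => [|j /eqP neq_jy].
  by rewrite /d1 appears_word_at // eqxx modn_small.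
rewrite /d1 appears_word_at //; case: eqP => // eq_jy.
by case: neq_jy; apply: val_inj.
Qed.

Lemma RS_seq_periodic (L k d : nat) (P : d.-tuple 'I_k) (mu : nat -> 'I_L)
    (A : nat) :
  1 < k -> nonzero_pattern P -> (forall y, A <= y -> mu y = 0 :> nat) ->
  ultimately_periodic (RS_seq P mu).
Proof.
move=> k_gt1 P_neq0 mu0; exists 0, (k ^ (A + d)); split=> [|n _].
  by rewrite expn_gt0 ltnW.
rewrite !(@RS_seqE _ _ _ _ _ _ (n + k ^ (A + d)).+1) // ?ltnS ?leq_addr //.
congr (_ %% _); apply: eq_bigr => y _; rewrite /d1.
have [/mu0 -> | lt_yA] := leqP A y; first by do 2 case: ifP.
rewrite (@eq_appears _ _ _ (n + _) n) // => t lt_td.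
by apply/(digitDr _ k_gt1 (dvdnn _)); lia.
Qed.

(** * Constancy along a progression *)

(** The correction [N + ((l - 1) * x) %% l] moves [x] into the progression, is
    small, and is the same for [x] and [z]. *)
Lemma RS_seq_eq_mod (L k d : nat) (P : d.-tuple 'I_k) (mu : nat -> 'I_L)
    (N l c : nat) :
  1 < k -> nonzero_pattern P -> 0 < l ->
  (forall t, RS_seq P mu (N + t * l) = c) ->
  exists B, forall x z, k ^ B %| x -> k ^ B %| z -> x = z %[mod l] ->
    RS_seq P mu x = RS_seq P mu z %[mod L].
Proof.
move=> k_gt1 P_neq0 l_gt0 const; exists (N + l + d) => x z dvd_x dvd_z eq_xz.
pose low w := N + ((l - 1) * w) %% l.
have low_lt w : low w < k ^ (N + l).
  apply: leq_ltn_trans (ltn_expl (N + l) k_gt1).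
  by rewrite leq_add2l ltnW // ltn_pmod.
have value w : k ^ (N + l + d) %| w ->
    RS_seq P mu (low w) + RS_seq P mu w = c %[mod L].
  move=> dvd_w; have /dvdnP[t tE] : l %| ((l - 1) * w) %% l + w.
    by rewrite /dvdn modnDml -{2}[w]mul1n -mulnDl subnK // modnMr.
  rewrite -(const t) -tE addnA RS_seqD // => y.
  exact: (d1D _ _ k_gt1 P_neq0 (low_lt w)).
have low_eq : low x = low z.
  by rewrite /low -modnMmr eq_xz modnMmr.
have := value x dvd_x; rewrite low_eq -(value z dvd_z) => /eqP.
by rewrite eqn_modDl => /eqP.
Qed.

Lemma RS_seq_addX (L k d : nat) (P : d.-tuple 'I_k) (mu : nat -> 'I_L)
    (N l c : nat) :
  1 < k -> nonzero_pattern P -> 0 < l ->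
  (forall t, RS_seq P mu (N + t * l) = c) ->
  exists B, forall u x, B <= u -> k ^ B %| x ->
    RS_seq P mu (x + k ^ u) = RS_seq P mu x + RS_seq P mu (k ^ u) %[mod L].
Proof.
move=> k_gt1 P_neq0 l_gt0 const.
have [B eq_mod] := RS_seq_eq_mod k_gt1 P_neq0 l_gt0 const.
have [C [s [s_gt0 per]]] := expn_mod_periodic k l_gt0.
exists (B + C) => u x le_u dvd_x.
have {}dvd_x : k ^ B %| x by apply: dvdn_trans dvd_x; rewrite dvdn_exp2l ?leq_addr.
have dvd_X v : u <= v -> k ^ B %| k ^ v by move=> le_uv; rewrite dvdn_exp2l //; lia.
(* The power congruent to [k ^ u] must clear all digits of [x] by a gap [d]. *)
pose v := u + (x + d) * s.
have eq_vu : k ^ v = k ^ u %[mod l] by apply: per; lia.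
have le_uv : u <= v by apply: leq_addr.
rewrite (eq_mod _ (x + k ^ v)) ?dvdn_add ?dvd_X //; last first.
  by rewrite -modnDmr -eq_vu modnDmr.
rewrite RS_seqD // => [|y].
  by rewrite -modnDmr (eq_mod _ (k ^ u)) ?dvd_X // modnDmr.
apply: (d1D _ _ k_gt1 P_neq0 (ltn_expl x k_gt1)).
by rewrite dvdn_exp2l // /v; nia.
Qed.

(** If the pattern is a single 1 among zeros, the 1 has a neighbouring 0.  When
    the 0 is below, a third 1 on top of the run 11 creates no occurrence and
    destroys none; when the 0 is above, the same holds for a second 1 below a
    single 1.  Additivity then kills the value at the inserted power. *)
Lemma RS_seq_power_eq0 (L k d : nat) (P : d.-tuple 'I_k) (mu : nat -> 'I_L)
    (B : nat) :
  1 < k -> 1 < d -> nonzero_pattern P ->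
  (forall u x, B <= u -> k ^ B %| x ->
    RS_seq P mu (x + k ^ u) = RS_seq P mu x + RS_seq P mu (k ^ u) %[mod L]) ->
  exists2 u, B <= u & RS_seq P mu (k ^ u) = 0 %[mod L].
Proof.
move=> k_gt1 d_gt1 P_neq0 addX.
have dvd_X v : B <= v -> k ^ B %| k ^ v by move=> le_Bv; rewrite dvdn_exp2l.
(* Adding [k ^ u] to [x] without changing the occurrences leaves the value at
   [x] unchanged, while additivity changes it by the value at [k ^ u]. *)
have insertion u x : B <= u -> k ^ B %| x ->
    (forall y, appears P (x + k ^ u) y = appears P x y) ->
    RS_seq P mu (k ^ u) = 0 %[mod L].
  move=> le_Bu dvd_x eq_app; have := addX u x le_Bu dvd_x.
  rewrite (eq_RS_seq _ k_gt1 P_neq0 eq_app) -{1}[RS_seq P mu x]addn0 => /eqP.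
  by rewrite eqn_modDl => /eqP.
have lt_X u v : u < v -> k ^ u < k ^ v by rewrite ltn_exp2l.
have dig2 q : digit k (k ^ B + k ^ B.+1) q = (q == B) + (q == B.+1).
  by rewrite (@digitD _ _ _ B.+1) ?lt_X // !digitX.
have dig3 q : digit k (k ^ B + k ^ B.+1 + k ^ B.+2) q
    = (q == B) + (q == B.+1) + (q == B.+2).
  rewrite (@digitD _ _ _ B.+2) ?dig2 ?digitX // !expnS.
  by have : 0 < k ^ B; [rewrite expn_gt0 ltnW | nia].
have [/existsP[j /forallP letE] | not_single] :=
  boolP [exists j : 'I_d, [forall t : 'I_d, letter P t == (t == j)]]; last first.
  exists B => //; rewrite (@eq_RS_seq _ _ _ _ _ _ 0) ?RS_seq0 // => y.
  rewrite [RHS]appears_zeros // => [|t _]; last by rewrite /digit div0n mod0n.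
  apply/appearsP => app; case: (letter_neq0 P_neq0) => t lt_td.
  rewrite -app // digitX // -lt0n lt0b => /eqP yt_eq; case/existsP: not_single.
  exists (Ordinal lt_td); apply/forallP => t'; rewrite -app // digitX //.
  by rewrite -val_eqE /= -yt_eq eqn_add2l.
(* From here on the pattern is a single 1 with [j] zeros below it. *)
have {}letE t : t < d -> letter P t = (t == j).
  by move=> lt_td; apply/eqP/(letE (Ordinal lt_td)).
have lt_jd := ltn_ord j.
have d_gt0 := ltnW d_gt1.
have [j0 | j_gt0] := posnP j.
  exists B => //; apply: (insertion _ (k ^ B.+1)) => //; first exact: dvd_X.
  move=> y; rewrite addnC; have [-> | neq_yB] := eqVneq y B.
    apply/appearsP/appearsP => app.
      by have := app 1 d_gt1; rewrite dig2 letE // j0; lia.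
    by have := app 0 d_gt0; rewrite digitX // letE // j0; lia.
  have [lt_yB | lt_By] := ltnP y B.
    by apply/appearsP/appearsP => /(_ 0 d_gt0);
      rewrite ?dig2 ?digitX // letE // j0; lia.
  by apply: eq_appears => t _; rewrite dig2 digitX //; lia.
(* In 11 and in 111 alike, the only 1 with a 0 below it is the one at [B], and
   it has a 1 above it; an occurrence therefore ends at [B]. *)
exists B.+2; first by lia.
apply: (insertion _ (k ^ B + k ^ B.+1)); [by lia | by rewrite dvdn_add ?dvd_X |].
move=> y; have lt_j1 : j.-1 < d by lia.
have [yj_eq | yj_neq] := eqVneq (y + j) B; last first.
  by apply/appearsP/appearsP => app; have := app _ lt_jd; have := app _ lt_j1;
    rewrite ?dig2 ?dig3 !letE //; lia.
have [lt_j1d | le_dj1] := ltnP j.+1 d.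
  by apply/appearsP/appearsP => app; have := app _ lt_j1d;
    rewrite ?dig2 ?dig3 !letE //; lia.
by apply: eq_appears => t lt_td; rewrite dig2 dig3; lia.
Qed.

(** * Vanishing of the weights *)

Lemma mu_eventually0 (L k d : nat) (P : d.-tuple 'I_k) (mu : nat -> 'I_L)
    (N l : nat) :
  1 < k -> 1 < d -> nonzero_pattern P -> 0 < l ->
  ultimately_periodic (arith_subseq (RS_seq P mu) N l) ->
  exists A, forall y, A <= y -> mu y = 0 :> nat.
Proof.
move=> k_gt1 d_gt1 P_neq0 l_gt0 [T [m [m_gt0 per]]].
have const t : RS_seq P mu (N + T * l + t * (m * l)) = RS_seq P mu (N + T * l).
  elim: t => [|t IHt]; first by rewrite mul0n addn0.
  rewrite -IHt; have /esym := per (T + t * m) (leq_addr _ _).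
  by rewrite /arith_subseq !mulnDl mulSn -!mulnA !addnA addnAC.
have ml_gt0 : 0 < m * l by rewrite muln_gt0 m_gt0.
have [B addX] := RS_seq_addX k_gt1 P_neq0 ml_gt0 const.
have [u le_Bu Xu0] := RS_seq_power_eq0 k_gt1 d_gt1 P_neq0 addX.
have multiples z : RS_seq P mu (k ^ u * z) = 0 %[mod L].
  elim: z => [|z IHz]; first by rewrite muln0 RS_seq0.
  rewrite mulnS addnC addX //; last by rewrite dvdn_mulr ?dvdn_exp2l.
  by rewrite -modnDm IHz Xu0 modnDm.
exists u => y le_uy; have := multiples (word_at P y %/ k ^ u).
rewrite mulnC divnK; last by rewrite dvdn_mulr ?dvdn_exp2l.
by rewrite RS_seq_word // mod0n modn_small.
Qed.

Theorem theorem2p1 (L k d : nat) (P : d.-tuple 'I_k) (mu : nat -> 'I_L) :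
  2 <= L -> 2 <= k -> 2 <= d -> nonzero_pattern P ->
  (ultimately_periodic (RS_seq P mu) <->
     exists A : int, forall y : nat, (A <= y%:Z)%R -> mu y = 0 :> nat) /\
  (~ ultimately_periodic (RS_seq P mu) ->
     forall N l : nat, 0 < l ->
       ~ ultimately_periodic (arith_subseq (RS_seq P mu) N l)).
Proof.
move=> _ k_gt1 d_gt1 P_neq0; split; first split.
- move=> [T [m [m_gt0 per]]].
  have [|A mu0] := @mu_eventually0 L k d P mu 0 1 k_gt1 d_gt1 P_neq0 isT.
    by exists T, m; split=> // n; rewrite /arith_subseq !muln1; apply: per.
  by exists A%:Z%R => y; rewrite lez_nat; apply: mu0.
- move=> [A mu0]; apply: (@RS_seq_periodic _ _ _ _ _ `|A|%N) => // y le_Ay.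
  by apply: mu0; lia.
- move=> not_per N l l_gt0 per; apply: not_per.
  have [A mu0] := mu_eventually0 k_gt1 d_gt1 P_neq0 l_gt0 per.
  exact: RS_seq_periodic mu0.
Qed.
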